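(* Let $q>2$ be a prime power and $n=q^2-1$. Let $a,b$ be integers with $0\le a\le q-1$ and $1\le b\le q$. Then there exists a QUENTA code with parameters (1) $[[n,\,2(q-b)-1,\,b+1;\,2(q-a-1)]]_q$, if $a\ge q-b$ and $b<q$; (2) $[[n,\,2a+1,\,b+1;\,2b-\lfloor b/q\rfloor]]_q$, if $a<q-b$.
   Context: A QUENTA code (entanglement-assisted quantum error-correcting code) with parameters $[[n,k,d;c]]_q$ is a $q$-ary entanglement-assisted quantum stabilizer code that encodes $k$ logical qudits into $n$ physical qudits using $c$ pairs of maximally entangled qudits pre-shared between sender and receiver, and has minimum distance $d$. *)

(* Defs.v *)
From HB Require Import structures.
From mathcomp Require Import all_boot all_order all_algebra all_field.
Set Implicit Arguments. Unset Strict Implicit. Unset Printing Implicit Defensive.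
Import GRing.Theory.
Local Open Scope ring_scope.

(* Standard symplectic form on F^{2n}: <(a|b),(a'|b')> = a.b' - b.a',
   i.e. u *m symJ *m v^T with symJ = [[0, I], [-I, 0]]. *)
Definition symJ (F : fieldType) (n : nat) : 'M[F]_(n + n) :=
  block_mx 0 1%:M (- 1%:M) 0.

Definition symp_dual (F : fieldType) (n m : nat) (S : 'M[F]_(m, n + n)) :
  'M[F]_(n + n) := kermx (symJ F n *m S^T).

Definition swt (F : fieldType) (n : nat) (v : 'rV[F]_(n + n)) : nat :=
  #|[set i : 'I_n | (v ord0 (lshift n i) != 0%R) || (v ord0 (rshift n i) != 0%R)]|.

(* Existence of a q-ary QUENTA code [[n,k,d;c]]_q (q = #|F|):
   an F_q-linear "stabilizer" subspace S <= F_q^{2n} (Alice's side) with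
   dim S = n - k + c and dim (S cap S^perp_s) = n - k - c (so the symplectic
   form has rank 2c on S: c ebits), and minimum distance exactly d, i.e.
   d = min { swt v | v in S^perp_s \ S }  (= S^perp_s minus its isotropic part
   S cap S^perp_s, the undetectable non-trivial errors). *)
Definition QUENTA_code (F : finFieldType) (n k d c : nat) : Prop :=
  exists (m : nat) (S : 'M[F]_(m, n + n)),
    [/\ (\rank S + k = n + c)%N,
        (\rank (S :&: symp_dual S)%MS + k + c = n)%N,
        (exists v : 'rV[F]_(n + n),
            [/\ (v <= symp_dual S)%MS, ~~ (v <= S)%MS & swt v = d])
      & (forall v : 'rV[F]_(n + n),
            (v <= symp_dual S)%MS -> ~~ (v <= S)%MS -> (d <= swt v)%N)].

(* Main.v *)
Require Import Defs.
From HB Require Import structures.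
From mathcomp Require Import all_boot all_order all_algebra all_field.
From mathcomp Require Import all_fingroup all_solvable.
From mathcomp Require Import zify.

(** The code is of CSS type.  Given three blocks of rows [P], [G], [K] (with
    [c], [x] and [k] rows, jointly independent), the space
    [S = <P, G> (+) <G, K>^perp] has symplectic radical of codimension [2c],
    and its distance is governed by the weights in [<G, K>] and in
    [<P, G>^perp].

    Let [L] be the field with [q^2] elements, whose nonzero elements index the
    coordinates.  The rows are the words [tr (c x^e)] for [e = 0, .., q - 2],
    with [c] running over a basis of [L] over [F] (only one [c] if [e = 0]),
    followed by one more word of exponent [2q - 2].  Every combination of these
    [2q - 2] words is a polynomial function of degree at most [(q - 1)^2], so
    its weight is at least [2q - 2].  A word orthogonal to the first [2b - 1]
    rows has vanishing moments of order [< b], so its weight is at least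
    [b + 1]; this is attained by a word supported on [b + 1] points of the line
    [theta + F], where divided differences provide the coefficients.

    In case (1), [P, G, K] are consecutive blocks of rows.  In case (2), [G] is
    empty and the first [2b - 1] rows are completed to [P] by any vector that
    is orthogonal to the minimum weight word and outside the span of the
    rows. *)

Set Implicit Arguments.
Unset Strict Implicit.
Unset Printing Implicit Defensive.
Import GRing.Theory.
Local Open Scope ring_scope.

(** * Quadratic extension of a finite field *)

Lemma exists_quadratic_ext (F : finFieldType) :
  exists (L : finFieldType) (f : {rmorphism F -> L}), #|L| = (#|F| ^ 2)%N.
Proof.
(* The map [x ^+ 2 - x] takes the same value at 0 and 1, so on a finite field it also misses some
   [d]. This yields an irreducible quadratic in every characteristic. *)
have [d Hd] : exists d : F, forall x, x ^+ 2 - x != d.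
  case: (boolP [exists d : F, [forall x, x ^+ 2 - x != d]]) => [/existsP[d /forallP]|]; first by exists d.
  rewrite negb_exists => /forallP H.
  pose f (x : F) := x ^+ 2 - x.
  have H1 d : exists x, f x = d.
    by have /= := H d; rewrite negb_forall => /existsP[x]; rewrite negbK => /eqP; exists x.
  have [g Hg] := fin_all_exists H1.
  have gi : injective g by apply: (can_inj Hg).
  have [h _ hK] := injF_bij gi.
  have e0 : f 0 = f 1 by rewrite /f !expr2 mul0r mul1r !subrr.
  have : (0 : F) = 1 by rewrite -(hK 0) -(hK 1) -[h 0]Hg -[h 1]Hg !hK e0.
  by move/eqP; rewrite eq_sym oner_eq0.
pose p : {poly F} := 'X^2 - 'X - d%:P.
have sp : size p = 3%N.
  rewrite /p -addrA size_polyDl size_polyXn // -opprD size_polyN.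
  by rewrite size_XaddC.
have ip : irreducible_poly p.
  apply: cubic_irreducible; rewrite ?sp // => x.
  by rewrite /root /p !hornerE subr_eq0; apply: Hd.
have [L dL _] := irredp_FAdjoin ip.
exists (finvect_type L), (in_alg L).
have := card_vspace (fullv : {vspace finvect_type L}).
by rewrite card_vspacef [\dim _]dL sp.
Qed.

(** * Weights and the CSS construction *)

Definition wt (F : fieldType) n (y : 'rV[F]_n) : nat := #|[set i | y ord0 i != 0]|.

Lemma wt_le_swt (F : fieldType) n (a b : 'rV[F]_n) :
  (wt a <= swt (row_mx a b))%N /\ (wt b <= swt (row_mx a b))%N.
Proof.
split; apply/subset_leq_card/subsetP => i; rewrite !inE row_mxEl row_mxEr => ->;
  by rewrite ?orbT.
Qed.

Lemma swt_row_mx0 (F : fieldType) n (b : 'rV[F]_n) : swt (row_mx 0 b) = wt b.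
Proof.
by apply: eq_card => i; rewrite !inE row_mxEl row_mxEr mxE eqxx.
Qed.

Lemma rank_antidiag_block_mx (F : fieldType) m n p r
    (A : 'M[F]_(m, n)) (B : 'M[F]_(p, r)) :
  \rank (block_mx 0 A B 0) = (\rank A + \rank B)%N.
Proof.
have <- : block_mx A 0 0 B *m block_mx 0 1%:M 1%:M 0 = block_mx 0 A B 0.
  by rewrite mulmx_block !mulmx0 !mul0mx !mulmx1 !addr0 !add0r.
rewrite mxrankMfree ?rank_diag_block_mx //.
apply: inj_row_free => v; rewrite -[v]hsubmxK mul_row_block.
rewrite !mulmx0 !mulmx1 addr0 add0r => /eqP; rewrite row_mx_eq0.
by case/andP=> /eqP -> /eqP ->; rewrite row_mx0.
Qed.

Section CSS.
Variables (F : finFieldType) (n c x k d : nat).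
Variables (P : 'M[F]_(c, n)) (G : 'M[F]_(x, n)) (K : 'M[F]_(k, n)).

(** The symplectic dual of [S] pairs a word of [D] with a word orthogonal to [E], so a nonzero dual
    vector has a half covered by one of the two weight hypotheses. The word [w], placed in the
    second half, attains the bound. *)
Lemma QUENTA_of_blocks :
    row_free (col_mx P (col_mx G K)) ->
    (forall y : 'rV_n, (y <= col_mx G K)%MS -> y != 0 -> (d <= wt y)%N) ->
    (forall y : 'rV_n, y *m P^T = 0 -> y *m G^T = 0 -> y != 0 -> (d <= wt y)%N) ->
    (exists w : 'rV_n, [/\ w *m P^T = 0, w *m G^T = 0, w *m K^T != 0 & wt w = d]) ->
  QUENTA_code F n k d c.
Proof.
move=> free dD dE [w [wP wG wK ww]].
set D := col_mx G K in free dD *.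
set E := col_mx P G.
(* The row space of [Q] is the Euclidean dual of [D]. *)
pose Q := (cokermx D)^T.
pose S := block_mx E 0 0 Q.
have inj (u : 'rV_c) (v : 'rV_(x + k)) : u *m P + v *m D = 0 -> u = 0 /\ v = 0.
  rewrite -mul_row_col => H.
  have : row_mx u v = row_mx 0 0.
    by apply: (row_free_inj free); rewrite row_mx0 mul0mx.
  by move=> /eq_row_mx.
have rD : \rank D = (x + k)%N.
  apply/eqP; apply: inj_row_free => v H.
  by have [] := inj 0 v; rewrite ?mul0mx ?add0r.
have rE : \rank E = (c + x)%N.
  apply/eqP; apply: inj_row_free => v.
  rewrite -[v]hsubmxK mul_row_col => H.
  have [|-> /eqP] := inj (lsubmx v) (row_mx (rsubmx v) 0).
    by rewrite mul_row_col mul0mx addr0.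
  by rewrite row_mx_eq0 => /andP[/eqP -> _]; rewrite row_mx0.
have lDn : (x + k <= n)%N by rewrite -rD rank_leq_col.
have rS : \rank S = (c + x + (n - (x + k)))%N.
  by rewrite rank_diag_block_mx rE mxrank_tr mxrank_coker rD.
(* The symplectic form crosses the halves: [a] is tested against [Q], whose dual is [D], and [b]
   against [E]. *)
have dualE (a b : 'rV_n) : (row_mx a b <= symp_dual S)%MS ->
    [/\ (a <= D)%MS, b *m P^T = 0 & b *m G^T = 0].
  rewrite sub_kermx mulmxA /symJ mul_row_block !mulmx0 mulmx1 mulmxN mulmx1.
  rewrite add0r addr0 /S tr_block_mx !trmx0 trmxK mul_row_block !mulmx0.
  rewrite add0r addr0 row_mx_eq0 mulNmx oppr_eq0 tr_col_mx mul_mx_row row_mx_eq0.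
  by case/andP => /andP[/eqP -> /eqP ->] H; rewrite submxE.
(* Modulo [D] the rows of [G] vanish and those of [P] stay independent. The Gram matrix of [S] has
   this matrix and minus its transpose as antidiagonal blocks, hence rank [c + c]. *)
have rEQ : \rank (E *m cokermx D) = c.
  have GD : (G <= D)%MS.
    apply/submxP; exists (row_mx 1%:M 0).
    by rewrite mul_row_col mul1mx mul0mx addr0.
  have G0 : G *m cokermx D = 0 by apply/eqP; rewrite -submxE.
  rewrite mul_col_mx G0 -addsmxE addsmx0.
  apply/eqP; apply: inj_row_free => u; rewrite mulmxA => /eqP.
  rewrite -submxE => /submxP[v Hv].
  by have [] := inj u (- v); rewrite // mulNmx Hv subrr.
have rJ : \rank (S *m (symJ F n *m S^T)) = (c + c)%N.
  rewrite mulmxA /S /symJ mulmx_block !mulmx0 !mul0mx !mulmx1 mulmxN mulmx1 !add0r !addr0.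
  rewrite tr_block_mx !trmx0 mulmx_block !mulmx0 !mul0mx !add0r ?addr0.
  rewrite rank_antidiag_block_mx trmxK rEQ mulNmx mxrank_opp.
  by rewrite -mxrank_tr trmx_mul !trmxK rEQ.
exists _, S; split.
- by rewrite rS; lia.
- have := mxrank_mul_ker S (symJ F n *m S^T); rewrite rJ rS -/(symp_dual S).
  by have := rank_leq_col S; lia.
- exists (row_mx 0 w); split; last by rewrite swt_row_mx0.
    rewrite sub_kermx mulmxA /symJ mul_row_block !mulmx0 mulmx1 mulmxN mulmx1.
    rewrite add0r addr0 /S tr_block_mx !trmx0 mul_row_block !mulmx0 !mul0mx.
    by rewrite !addr0 mulNmx tr_col_mx mul_mx_row wP wG row_mx0 oppr0 row_mx0.
  (* Membership in [S] would put [w] in the row space of [Q], hence make it orthogonal to [K]. *)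
  apply: contra wK => /submxP[z].
  rewrite -[z]hsubmxK mul_row_block !mulmx0 addr0 add0r => /eq_row_mx[_ ->].
  rewrite /Q -mulmxA -trmx_mul.
  have := mulmx_coker D; rewrite mul_col_mx => /eqP.
  by rewrite col_mx_eq0 => /andP[_ /eqP ->]; rewrite trmx0 mulmx0.
- move=> v; rewrite -[v]hsubmxK => /dualE[aD bP bG] vS.
  have [la lb] := wt_le_swt (lsubmx v) (rsubmx v).
  have [a0|a0] := eqVneq (lsubmx v) 0; last exact: leq_trans (dD _ aD a0) la.
  have [b0|b0] := eqVneq (rsubmx v) 0; last exact: leq_trans (dE _ bP bG b0) lb.
  by rewrite a0 b0 row_mx0 sub0mx in vS.
Qed.
End CSS.

(** * Words with vanishing moments *)

Lemma vanishing_moments_poly (F : fieldType) (I : finType) (f y : I -> F) m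
    (p : {poly F}) :
    (forall j, (j < m)%N -> \sum_i y i * f i ^+ j = 0) -> (size p <= m)%N ->
  \sum_i y i * p.[f i] = 0.
Proof.
move=> H sp; under eq_bigr => l _ do rewrite horner_coef mulr_sumr.
rewrite exchange_big big1 // => j _.
under eq_bigr => l _ do rewrite mulrCA.
by rewrite -mulr_sumr H ?mulr0 // (leq_trans _ sp).
Qed.

(** If [y i] were nonzero, the product of ['X - f j] over the other support points would have size
    at most [m]; summing [y] against its values leaves only the nonzero term at [i]. *)
Lemma vanishing_moments_eq0 (F : fieldType) (I : finType) (f y : I -> F) m :
    injective f -> (#|[set i | y i != 0%R]| <= m)%N ->
    (forall j, (j < m)%N -> \sum_i y i * f i ^+ j = 0) ->
  forall i, y i = 0.
Proof.
move=> fi; set A := [set i | y i != 0] => Am H i.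
have Hp p := @vanishing_moments_poly F I f y m p H.
apply: contraTeq isT => yi.
have iA : i \in A by rewrite inE.
pose p := \prod_(j <- enum (A :\ i)) ('X - (f j)%:P).
have /Hp : (size p <= m)%N.
  by rewrite size_prod_XsubC -cardE; move: Am; rewrite (cardsD1 i) iA.
rewrite (bigD1 i) //= big1 ?addr0 => [/eqP|j ji].
  rewrite mulf_eq0 (negPf yi) horner_prod prodf_seq_eq0 /= => /hasP[j].
  by rewrite mem_enum !inE !hornerE subr_eq0 => /andP[/eqP ij _] /eqP/fi/esym.
have [->|yj] := eqVneq (y j) 0; first by rewrite mul0r.
by rewrite horner_prod (bigD1_seq j) /= ?mem_enum ?inE ?ji ?enum_uniq // hornerXsubC subrr mul0r mulr0.
Qed.

(** There are [b] equations in [b.+1] unknowns; a nonzero solution whose moment of order [b] also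
    vanished would contradict the Vandermonde argument above. *)
Lemma exists_moment_word (F : fieldType) b (t : 'I_b.+1 -> F) : injective t ->
  exists z : 'I_b.+1 -> F, (forall j, (j < b)%N -> \sum_s z s * t s ^+ j = 0) /\
    \sum_s z s * t s ^+ b != 0.
Proof.
move=> ti; pose A := \matrix_(s < b.+1, j < b) t s ^+ j.
have : kermx A != 0.
  by rewrite kermx_eq0 /row_free; have := rank_leq_col A; lia.
case/rowV0Pn=> v /sub_kermxP vA v0; exists (v 0).
have H j : (j < b)%N -> \sum_s v 0 s * t s ^+ j = 0.
  move=> jb; have /matrixP/(_ 0 (Ordinal jb)) := vA; rewrite !mxE => H.
  by rewrite -[RHS]H; apply: eq_bigr => s _; rewrite mxE.
split=> //; apply: contra v0 => /eqP Hb; apply/eqP/rowP => s; rewrite mxE.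
apply: (@vanishing_moments_eq0 F _ t (v 0) b.+1) => // [|j].
  by rewrite (leq_trans (max_card _)) // card_ord.
by rewrite ltnS leq_eqVlt => /predU1P[->|/H].
Qed.

Lemma monic_moment (L : fieldType) (I : finType) (z t : I -> L) b (p : {poly L}) :
    (forall j, (j < b)%N -> \sum_s z s * t s ^+ j = 0) ->
    p \is monic -> size p = b.+1 ->
  \sum_s z s * p.[t s] = \sum_s z s * t s ^+ b.
Proof.
move=> H pm sp; under eq_bigr => l _ do rewrite horner_coef mulr_sumr sp big_ord_recr /=.
have -> : p`_b = 1 by have := monicP pm; rewrite lead_coefE sp.
rewrite big_split /= exchange_big big1 ?add0r => [|j _].
  by apply: eq_bigr => s _; rewrite mul1r.
under eq_bigr => l _ do rewrite mulrCA.
by rewrite -mulr_sumr H ?mulr0.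
Qed.

(** * Frobenius and trace in the quadratic extension *)

Section QuadraticExtension.
Variables (F L : finFieldType) (iota : {rmorphism F -> L}).
Let q := #|F|.
Hypothesis cardL : #|L| = (q ^ 2)%N.

Lemma frobeniusD (x y : L) : (x + y) ^+ q = x ^+ q + y ^+ q.
Proof.
have [p pp pF] := finPcharP F.
have pL : p \in [pchar L] by rewrite (rmorph_pchar iota).
apply: exprDn_pchar; have := abelem_pgroup (fin_ring_pchar_abelem pF).
rewrite /pgroup cardsT -/q; apply: sub_in_pnat => r _; rewrite !inE => /eqP ->.
by have := pL; rewrite inE.
Qed.

Lemma frobenius_sum (I : finType) (f : I -> L) :
  (\sum_i f i) ^+ q = \sum_i f i ^+ q.
Proof.
apply: (big_morph (fun x : L => x ^+ q) frobeniusD).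
by rewrite expr0n /q -(prednK (ltnW (finNzRing_gt1 F))).
Qed.

Lemma frobenius_iota a : iota a ^+ q = iota a.
Proof. by rewrite -rmorphXn expf_card. Qed.

Lemma frobeniusK (x : L) : (x ^+ q) ^+ q = x.
Proof. by rewrite -exprM mulnn -cardL expf_card. Qed.

(** The image of [iota] already supplies [q] roots of ['X^q - 'X], so there is no room for
    another. *)
Lemma frobenius_fixed (x : L) : x ^+ q = x -> exists a, x = iota a.
Proof.
move=> xq; pose p : {poly L} := 'X^q - 'X.
have sp : size p = q.+1.
  by rewrite /p size_polyDl size_polyXn // size_polyN size_polyX ltnS finNzRing_gt1.
case: (boolP [exists a, x == iota a]) => [/existsP[a /eqP]|]; first by exists a.
rewrite negb_exists => /forallP H.
have := @max_poly_roots _ p (x :: codom iota).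
rewrite -size_poly_eq0 sp /= size_codom ltnn => /(_ isT) H0.
suff : false by [].
apply: H0; last first.
  rewrite (map_inj_uniq (fmorph_inj iota)) enum_uniq andbT.
  by apply/codomP => -[a xa]; have := H a; rewrite xa eqxx.
rewrite /root /p !hornerE xq subrr eqxx /=.
by apply/allP => _ /codomP[a ->]; rewrite /root !hornerE frobenius_iota subrr.
Qed.

Lemma exists_not_fixed : exists theta : L, theta ^+ q != theta.
Proof.
case: (boolP [exists x : L, x ^+ q != x]) => [/existsP[x]|]; first by exists x.
rewrite negb_exists => /forallP H.
have H1 x : exists a, x = iota a.
  by apply: frobenius_fixed; apply/eqP; have := H x; rewrite negbK.
have [g Hg] := fin_all_exists H1.
have /leq_card : injective g by move=> x y e; rewrite (Hg x) (Hg y) e.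
by have := finNzRing_gt1 F; rewrite cardL -/q -mulnn; nia.
Qed.

Lemma exists_trace : exists tr : L -> F, forall x, iota (tr x) = x + x ^+ q.
Proof.
have H x : exists a, iota a = x + x ^+ q.
  have [|a ->] := @frobenius_fixed (x + x ^+ q); last by exists a.
  by rewrite frobeniusD frobeniusK addrC.
by have [tr] := fin_all_exists H; exists tr.
Qed.

(** The witness 1 fails only if [-1 = 1]; then an element of trace 0 is fixed by Frobenius, which
    [theta] is not. *)
Lemma exists_trace_neq0 : exists c : L, c + c ^+ q != 0.
Proof.
have [theta nf] := exists_not_fixed.
have [e|] := eqVneq (1 + 1 ^+ q : L) 0; last by exists 1.
exists theta; apply: contra nf => /eqP e2.
have -> : theta ^+ q = - theta by apply/eqP; rewrite -addr_eq0 addrC e2.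
rewrite expr1n in e; have e1 : (-1 : L) = 1 by apply/eqP; rewrite eq_sym -addr_eq0 e.
by rewrite -mulN1r e1 mul1r.
Qed.

Lemma exists_points : exists pt : 'I_(q ^ 2 - 1) -> L,
  [/\ injective pt, forall i, pt i != 0 & forall x, x != 0 -> exists i, pt i = x].
Proof.
have cA : (q ^ 2 - 1)%N = #|[pred x : L | x != 0]|.
  by rewrite -cardL subn1 -(cardC1 (0 : L)); apply: eq_card => x; rewrite !inE.
exists (fun i => enum_val (cast_ord cA i)); split=> [i j /enum_val_inj/cast_ord_inj //|i|x x0].
  by have := enum_valP (cast_ord cA i).
have xA : x \in [pred x : L | x != 0] by [].
by exists (cast_ord (esym cA) (enum_rank_in xA x)); rewrite cast_ordKV enum_rankK_in.
Qed.
End QuadraticExtension.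

(** * Sparse sums and rowwise orthogonality *)

Lemma sum_support2 (V : zmodType) m (f : nat -> V) s t :
    (s < m)%N -> (t < m)%N -> s != t ->
    (forall j, (j < m)%N -> j != s -> j != t -> f j = 0) ->
  \sum_(j < m) f j = f s + f t.
Proof.
move=> sm tm st H.
rewrite (bigD1 (Ordinal sm)) //= (bigD1 (Ordinal tm)) /=; last by rewrite -val_eqE eq_sym.
rewrite big1 ?addr0 // => j /andP[]; rewrite -!val_eqE /= => js jt.
exact: H.
Qed.

Lemma sum_support1 (V : zmodType) m (f : nat -> V) s :
    (s < m)%N -> (forall j, (j < m)%N -> j != s -> f j = 0) ->
  \sum_(j < m) f j = f s.
Proof.
move=> sm H; rewrite (bigD1 (Ordinal sm)) //= big1 ?addr0 // => j; rewrite -val_eqE => js.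
exact: H.
Qed.

Lemma mul_trmx_eq0P (F : fieldType) m n (y : 'rV[F]_n) (A : 'M[F]_(m, n)) :
  y *m A^T = 0 <-> forall i, y *m (row i A)^T = 0.
Proof.
split=> [H i|H]; first by rewrite tr_row colE mulmxA H mul0mx.
apply/rowP => i; have /matrixP/(_ 0 0) := H i; rewrite !mxE => e.
by rewrite -[RHS]e; apply: eq_bigr => l _; rewrite !mxE.
Qed.

(** * The trace words, their span and its dual *)

Section Code.
Variables (F L : finFieldType) (iota : {rmorphism F -> L}).
Let q := #|F|.
Hypotheses (cardL : #|L| = (q ^ 2)%N) (q_gt2 : (2 < q)%N).
Variables (tr : L -> F) (theta c0 : L) (pt : 'I_(q ^ 2 - 1) -> L).
Hypotheses (trE : forall x, iota (tr x) = x + x ^+ q).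
Hypotheses (theta_nf : theta ^+ q != theta) (c0_tr : c0 + c0 ^+ q != 0).
Hypotheses (pt_inj : injective pt) (pt_neq0 : forall i, pt i != 0).
Hypothesis pt_surj : forall x, x != 0 -> exists i, pt i = x.

(* Row [0] is a nonzero constant; rows [2i - 1] and [2i] carry exponent [i].
   The last row, [2q - 3], does not use the exponent [q - 1]: its conjugate
   exponent [q (q - 1)] would be too large for the weight bound.  The exponent
   [2q - 2] has the smaller conjugate [(q - 1)^2] modulo [q^2 - 1], and
   [x^(2q - 2)] is still a monic polynomial of degree [q - 1] in [t] on the line
   [x = theta + t]. *)
Let cf j : L := if odd j || (j == 0)%N then c0 else c0 * theta.
Let ex j : nat := if (j == 2 * q - 3)%N then (2 * q - 2)%N else uphalf j.
Let ex' j : nat := if (j == 2 * q - 3)%N then ((q - 1) ^ 2)%N else (q * uphalf j)%N.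
Let ph j : 'rV[F]_(q ^ 2 - 1) := \row_i tr (cf j * pt i ^+ ex j).
Let rows m : 'M[F]_(m, q ^ 2 - 1) := \matrix_(j < m) ph j.

Lemma c0_neq0 : c0 != 0.
Proof.
by apply: contraNneq c0_tr => ->; rewrite expr0n add0r; case: (q) q_gt2.
Qed.

Lemma theta_free (x y : F) : iota x + iota y * theta = 0 -> x = 0 /\ y = 0.
Proof.
move=> H; have [y0|y0] := eqVneq y 0.
  by move: H; rewrite y0 rmorph0 mul0r addr0 => /eqP; rewrite fmorph_eq0 => /eqP.
case/negP: theta_nf.
have -> : theta = iota (- x / y).
  rewrite fmorph_div rmorphN; apply: (mulfI (x := iota y)); first by rewrite fmorph_eq0.
  by rewrite mulrC mulrCA divff ?fmorph_eq0 // mulr1 mulrC; apply/eqP; rewrite -addr_eq0 addrC H.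
by rewrite frobenius_iota.
Qed.

Lemma conj_pt i j : (pt i ^+ ex j) ^+ q = pt i ^+ ex' j.
Proof.
rewrite -exprM /ex /ex'; case: ifP => _; last by rewrite mulnC.
have p1 : pt i ^+ (q ^ 2 - 1) = 1.
  apply: (mulfI (pt_neq0 i)); rewrite -exprS mulr1.
  have -> : (q ^ 2 - 1).+1 = #|L| by rewrite cardL -mulnn; nia.
  by rewrite expf_card.
have -> : ((2 * q - 2) * q = (q - 1) ^ 2 + (q ^ 2 - 1))%N by rewrite -!mulnn; nia.
by rewrite exprD p1 mulr1.
Qed.

Let wpoly (a : nat -> F) : {poly L} :=
  \sum_(j < 2 * q - 2) iota (a j) *: (cf j *: 'X^(ex j) + cf j ^+ q *: 'X^(ex' j)).

Lemma wpoly_pt a i :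
  (wpoly a).[pt i] = iota ((\sum_(j < 2 * q - 2) a j *: ph j) 0 i).
Proof.
rewrite /wpoly horner_sum summxE rmorph_sum; apply: eq_bigr => j _.
by rewrite !hornerE !mxE rmorphM trE exprMn conj_pt.
Qed.

(** Away from the last row the largest conjugate exponent is [q (q - 2) = (q - 1)^2 - 1]; the last
    row reaches [(q - 1)^2]. *)
Lemma size_wpoly a : (size (wpoly a) <= (q - 1) ^ 2 + 1)%N.
Proof.
apply: (leq_trans (size_sum _ _ _)); apply/bigmax_leqP => j _.
apply: (leq_trans (size_scale_leq _ _)).
apply: (leq_trans (size_polyD _ _)); rewrite geq_max.
have jq := ltn_ord j.
apply/andP; split; apply: (leq_trans (size_scale_leq _ _)); rewrite size_polyXn addn1 ltnS.
  by rewrite /ex -mulnn; case: eqP => _; have := half_leq (ltnW jq); nia.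
rewrite /ex' -mulnn; case: eqP => // /eqP ne.
have : (uphalf j <= q - 2)%N by move: ne jq; lia.
by nia.
Qed.

(** Coefficients are read off at well-chosen exponents. For [0 < i <= q - 2], ['X^i] comes only from
    rows [2i - 1] and [2i], whose factors [c0] and [c0 * theta] are independent over [F]. Exponents
    [0] and [2q - 2] isolate the first and the last row. *)
Lemma wpoly_eq0 a : wpoly a = 0 -> forall j, (j < 2 * q - 2)%N -> a j = 0.
Proof.
move=> w0.
pose g e j := iota (a j) * (cf j * (e == ex j)%:R + cf j ^+ q * (e == ex' j)%:R).
have H e : \sum_(j < 2 * q - 2) g e j = 0.
  have := congr1 (fun p : {poly L} => p`_e) w0; rewrite /wpoly coef_sum coef0 => H.
  by rewrite -[RHS]H; apply: eq_bigr => j _; rewrite !coefE.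
have cc := c0_neq0.
have A0 : a 0%N = 0.
  have := H 0%N; rewrite (@sum_support1 _ _ (g 0%N) 0%N) /g => [||j jq j0]; last first.
  - have -> : (0 == ex j)%N = false by rewrite /ex; case: ifP; lia.
    have -> : (0 == ex' j)%N = false by rewrite /ex' -mulnn; case: ifP; nia.
    by rewrite !mulr0 addr0 mulr0.
  - by lia.
  rewrite /ex /ex' /cf /= ifF ?ifF ?eqxx; try by lia.
  rewrite muln0 eqxx !mulr1 => /eqP.
  by rewrite mulf_eq0 (negPf c0_tr) orbF fmorph_eq0 => /eqP.
have Ai i : (0 < i)%N -> (i <= q - 2)%N -> a (2 * i - 1)%N = 0 /\ a (2 * i)%N = 0.
  move=> i0 iq; have := H i.
  rewrite (@sum_support2 _ _ (g i) (2 * i - 1)%N (2 * i)%N) /g => [|||| j jq j1 j2]; try by lia.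
    have E1 : ex (2 * i - 1)%N = i by rewrite /ex; case: ifP; lia.
    have E2 : ex (2 * i)%N = i by rewrite /ex; case: ifP; lia.
    have E1' : (i == ex' (2 * i - 1)%N)%N = false.
      by rewrite /ex' -mulnn; case: ifP => [|_]; first (by lia); have : uphalf (2 * i - 1)%N = i; nia.
    have E2' : (i == ex' (2 * i)%N)%N = false.
      by rewrite /ex' -mulnn; case: ifP => [|_]; first (by lia); have : uphalf (2 * i)%N = i; nia.
    have C1 : cf (2 * i - 1)%N = c0 by rewrite /cf ifT //; lia.
    have C2 : cf (2 * i)%N = c0 * theta by rewrite /cf ifF //; lia.
    rewrite E1 E2 E1' E2' C1 C2 eqxx !mulr0 !mulr1 !addr0 => e.
    apply: theta_free; apply: (mulfI cc); rewrite mulr0 -e mulrDr.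
    by congr (_ + _); rewrite mulrC // -mulrA (mulrC theta).
  have -> : (i == ex j)%N = false by rewrite /ex; case: ifP; lia.
  have -> : (i == ex' j)%N = false.
    rewrite /ex' -mulnn; case: ifP => _; first by nia.
    by case: (uphalf j) => [|u]; nia.
  by rewrite !mulr0 addr0 mulr0.
have Al : a (2 * q - 3)%N = 0.
  have := H (2 * q - 2)%N; rewrite (@sum_support1 _ _ (g _) (2 * q - 3)%N) /g => [||j jq j0]; last first.
  - have -> : (2 * q - 2 == ex j)%N = false by rewrite /ex (negPf j0); lia.
    have -> : (2 * q - 2 == ex' j)%N = false 
      by rewrite /ex' (negPf j0); case: (uphalf j) => [|[|u]]; nia.
    by rewrite !mulr0 addr0 mulr0.
  - by lia.
  rewrite /ex /ex' /cf /= eqxx eqxx ifT; last by lia.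
  rewrite mulr1 => /eqP; rewrite mulf_eq0 fmorph_eq0 => /orP[/eqP //|].
  (* For [q = 3] the two exponents of the last row coincide and the factor is the trace of [c0];
     otherwise it is [c0]. *)
  by case: (_ == (q - 1) ^ 2)%N; rewrite ?mulr1 ?mulr0 ?addr0 ?(negPf c0_tr) ?(negPf cc).
move=> j jq; have [->|j0] := posnP j; first exact: A0.
have [->|jl] := eqVneq j (2 * q - 3)%N; first exact: Al.
have [|| B1 B2] := Ai (uphalf j); try by lia.
have [e|e] : j = (2 * uphalf j - 1)%N \/ j = (2 * uphalf j)%N by lia.
  by rewrite e.
by rewrite e.
Qed.

(** A nonzero combination is given by a nonzero polynomial with at most [(q - 1)^2] roots among the
    [q^2 - 1] points, and the difference is [2q - 2]. *)
Lemma rows_weight m (u : 'rV_m) : (m <= 2 * q - 2)%N -> u != 0 ->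
  (2 * q - 2 <= wt (u *m rows m))%N.
Proof.
move=> mq u0.
pose a j := oapp (u 0) 0 (insub j : option 'I_m).
have yE : u *m rows m = \sum_(j < 2 * q - 2) a j *: ph j.
  rewrite (eq_bigr (fun j : 'I__ => if (j < m)%N then a j *: ph j else 0)) => [|j _]; last first.
    by case: ifP => // jm; rewrite /a insubF //= scale0r.
  rewrite -big_mkcond /= -(big_ord_widen _ (fun j => a j *: ph j)) // mulmx_sum_row.
  by apply: eq_bigr => j _; rewrite /a valK rowK.
pose Z := [set i | (u *m rows m) 0 i == 0].
have wZ : (wt (u *m rows m) + #|Z| = q ^ 2 - 1)%N.
  rewrite -[RHS]card_ord -cardsT -(cardsID Z [set: _]) setTI addnC; congr (_ + _)%N.
  by apply: eq_card => i; rewrite !inE andbT.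
have w0 : wpoly a != 0.
  apply: contra u0 => /eqP/wpoly_eq0 H; apply/eqP/rowP => j; rewrite mxE.
  by have := H j (leq_trans (ltn_ord j) mq); rewrite /a valK.
have : (size [seq pt i | i in Z] < size (wpoly a))%N.
  apply: max_poly_roots => //; last by rewrite map_inj_uniq ?enum_uniq.
  apply/allP => _ /imageP[i iZ ->].
  by rewrite /root wpoly_pt -yE; move: iZ; rewrite inE => /eqP ->; rewrite rmorph0.
rewrite size_image => /leq_trans/(_ (size_wpoly a)).
by move: (wt _) (#|Z|) wZ => v s; rewrite -!mulnn; nia.
Qed.

Lemma rows_free m : (m <= 2 * q - 2)%N -> row_free (rows m).
Proof.
move=> mq; apply: inj_row_free => u H; apply: contraTeq isT => u0.
have := rows_weight mq u0; rewrite H.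
have -> : wt (0 : 'rV[F]_(q ^ 2 - 1)) = 0%N.
  by apply/eqP; rewrite cards_eq0; apply/eqP/setP => i; rewrite !inE mxE eqxx.
by lia.
Qed.

Lemma iota_dot (y : 'rV[F]_(q ^ 2 - 1)) j :
  iota ((y *m (ph j)^T) 0 0) =
  cf j * (\sum_i iota (y 0 i) * pt i ^+ ex j) +
  (cf j * (\sum_i iota (y 0 i) * pt i ^+ ex j)) ^+ q.
Proof.
rewrite exprMn (frobenius_sum iota) !mulr_sumr -big_split mxE rmorph_sum.
apply: eq_bigr => i _; rewrite !mxE rmorphM trE mulrDr exprMn.
by rewrite [(iota _ * _) ^+ q]exprMn frobenius_iota !(mulrCA (iota _)).
Qed.

(** Row [0] kills the moment of order 0, and rows [2m - 1] and [2m] together kill the moment of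
    order [m]. A word of weight at most [b] with [b] vanishing moments is zero. *)
Lemma dual_weight b (y : 'rV[F]_(q ^ 2 - 1)) : (1 <= b < q)%N ->
    (forall j, (j < 2 * b - 1)%N -> y *m (ph j)^T = 0) -> y != 0 ->
  (b + 1 <= wt y)%N.
Proof.
move=> bq H y0; rewrite addn1 ltnNge; apply: contra y0 => yb.
have Hj j : (j < 2 * b - 1)%N ->
    cf j * (\sum_i iota (y 0 i) * pt i ^+ ex j) +
    (cf j * (\sum_i iota (y 0 i) * pt i ^+ ex j)) ^+ q = 0.
  by move=> jb; rewrite -iota_dot H // mxE rmorph0.
apply/eqP/rowP => i; rewrite mxE; apply: (fmorph_inj iota); rewrite rmorph0; move: i.
apply: (@vanishing_moments_eq0 _ _ pt _ b) => // [|m mb].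
  by apply: leq_trans yb; apply/subset_leq_card/subsetP => i; rewrite !inE fmorph_eq0.
have cc := c0_neq0.
have [m0|m0] := posnP m.
  have := Hj 0%N; rewrite /ex /cf ifF /= ?m0; last by lia.
  (* The moment of order 0 lies in [F], so it factors out of the trace and a single row suffices. *)
  set z := \sum_i _; have [a za] : exists a, z = iota a.
    by exists (\sum_i y 0 i); rewrite rmorph_sum; apply: eq_bigr => i _; rewrite mulr1.
  rewrite exprMn za frobenius_iota -mulrDl => /(_ _)/eqP.
  by rewrite mulf_eq0 (negPf c0_tr) /= => E; apply/eqP/E; lia.
have := Hj (2 * m - 1)%N; have := Hj (2 * m)%N.
have -> : ex (2 * m)%N = m by rewrite /ex; case: ifP; lia.
have -> : ex (2 * m - 1)%N = m by rewrite /ex; case: ifP; lia.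
have -> : cf (2 * m - 1)%N = c0 by rewrite /cf ifT //; lia.
have -> : cf (2 * m)%N = c0 * theta by rewrite /cf ifF //; lia.
set z := \sum_i _ => /= E1 E2; have {}E1 := E1 ltac:(lia); have {}E2 := E2 ltac:(lia).
(* Zero trace gives [(c0 * z) ^+ q = - (c0 * z)]; substituting this into the relation twisted by
   [theta] leaves this product. *)
have : (theta - theta ^+ q) * (c0 * z) = 0.
  have e : (c0 * z) ^+ q = - (c0 * z) by apply/eqP; rewrite -addr_eq0 addrC E2.
  by rewrite mulrBl -[RHS]E1 (mulrC c0 theta) -mulrA exprMn e mulrN.
by move/eqP; rewrite !mulf_eq0 subr_eq0 eq_sym (negPf theta_nf) (negPf cc) => /eqP.
Qed.

Lemma exists_min_word b : (1 <= b < q)%N ->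
  exists w : 'rV[F]_(q ^ 2 - 1),
    [/\ forall j, (j < 2 * b - 1)%N -> w *m (ph j)^T = 0,
        w *m (ph (2 * b - 1)%N)^T != 0 & wt w = (b + 1)%N].
Proof.
move=> bq; have bq' : (b.+1 <= #|F|)%N by rewrite -/q; lia.
(* As [b < q], [F] has [b + 1] distinct elements; the shifts [theta + t s] are nonzero because
   [theta] lies outside [F]. *)
pose t (s : 'I_b.+1) : F := enum_val (cast_ord (erefl #|F|) (widen_ord bq' s)).
have ti : injective t.
  by move=> s s' /enum_val_inj/cast_ord_inj/(congr1 val) /= e; apply: val_inj.
have [z [z0 zb]] := exists_moment_word ti.
have thF a : theta + iota a != 0.
  apply: contra theta_nf; rewrite addr_eq0 => /eqP ->.
  by rewrite -rmorphN frobenius_iota.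
have [ix ixE] := fin_all_exists (fun s => pt_surj (thF (t s))).
pose w : 'rV[F]_(q ^ 2 - 1) := \sum_s z s *: delta_mx 0 (ix s).
have ixi : injective ix.
  by move=> s s' e; apply: ti; apply: (fmorph_inj iota); apply: (addrI theta); rewrite -!ixE e.
have wsum (f : L -> L) : \sum_i iota (w 0 i) * f (pt i) = \sum_s iota (z s) * f (theta + iota (t s)).
  rewrite (eq_bigr (fun i => \sum_s iota (z s) * ((i == ix s)%:R * f (pt i)))) => [|i _].
    rewrite exchange_big; apply: eq_bigr => s _.
    by rewrite (bigD1 (ix s)) //= eqxx mul1r ixE big1 ?addr0 // => i /negPf ->; rewrite mul0r mulr0.
  rewrite /w summxE rmorph_sum mulr_suml; apply: eq_bigr => s _.
  by rewrite !mxE eqxx /= rmorphM rmorph_nat mulrA.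
have zL j : (j < b)%N -> \sum_s iota (z s) * iota (t s) ^+ j = 0.
  move=> jb; rewrite -[RHS](rmorph0 iota) -[in RHS](z0 j jb) rmorph_sum.
  by apply: eq_bigr => s _; rewrite rmorphM rmorphXn.
have wj j : (j < 2 * b - 1)%N -> w *m (ph j)^T = 0.
  move=> jb; apply/rowP => o; rewrite ord1 [RHS]mxE; apply: (fmorph_inj iota).
  rewrite iota_dot (wsum (fun x => x ^+ ex j)) rmorph0.
  have exb : (ex j < b)%N by rewrite /ex; case: ifP; lia.
  (* On the line, [x ^+ ex j] is a polynomial in [t] of degree [ex j < b]. *)
  have := @vanishing_moments_poly _ _ _ _ _ (('X - (- theta)%:P) ^+ ex j) zL.
  rewrite size_exp_XsubC => /(_ exb).
  under eq_bigr => s _ do rewrite horner_exp hornerXsubC opprK [iota _ + _]addrC.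
  by move=> -> /=; rewrite mulr0 expr0n add0r; case: (q) q_gt2.
have wb : w *m (ph (2 * b - 1)%N)^T != 0.
  apply/eqP => /(congr1 (fun M : 'M_1 => iota (M 0 0))).
  rewrite iota_dot [in RHS]mxE rmorph0 (wsum (fun x => x ^+ ex (2 * b - 1)%N)) /=.
  have -> : cf (2 * b - 1)%N = c0 by rewrite /cf ifT //; lia.
  (* For [b = q - 1] the row is the last one: with [t] in [F], [(theta + t)^(2q - 2) = (theta^q + t)
     (theta + t)^(q - 2)], a product of [q - 1] monic linear factors in [t]. *)
  have [p [pm sp pE]] : exists p : {poly L}, [/\ p \is monic, size p = b.+1 &
      forall a, p.[iota a] = (theta + iota a) ^+ ex (2 * b - 1)%N].
    have [->|bq1] := eqVneq b (q - 1)%N.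
      exists (('X - (- theta ^+ q)%:P) * ('X - (- theta)%:P) ^+ (q - 2)); split.
      - by rewrite monicMr ?monic_exp ?monicXsubC.
      - rewrite size_Mmonic ?monic_exp ?monicXsubC ?size_XsubC ?size_exp_XsubC //.
          by lia.
        by rewrite -size_poly_eq0 size_XsubC.
      - move=> a; rewrite hornerM horner_exp !hornerXsubC !opprK.
        rewrite -{1}(frobenius_iota iota a) -(frobeniusD iota) addrC -exprD /ex ifT; last by lia.
        by congr (_ ^+ _); lia.
    exists (('X - (- theta)%:P) ^+ b); split; rewrite ?monic_exp ?monicXsubC ?size_exp_XsubC //.
    move=> a; rewrite horner_exp hornerXsubC opprK addrC; congr (_ ^+ _).
    by rewrite /ex ifF; lia.
  under eq_bigr => s _ do rewrite -pE.
  rewrite (monic_moment zL pm sp).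
  have -> : \sum_s iota (z s) * iota (t s) ^+ b = iota (\sum_s z s * t s ^+ b).
    by rewrite rmorph_sum; apply: eq_bigr => s _; rewrite rmorphM rmorphXn.
  rewrite exprMn frobenius_iota -mulrDl => /eqP.
  by rewrite mulf_eq0 (negPf c0_tr) fmorph_eq0 (negPf zb).
exists w; split=> //; apply/eqP; rewrite eqn_leq dual_weight //; last first.
  by apply: contra wb => /eqP ->; rewrite mul0mx.
rewrite andbT -[(b + 1)%N](_ : #|codom ix| = _); last first.
  by rewrite card_codom // card_ord addn1.
apply/subset_leq_card/subsetP => i; rewrite inE; apply: contraR => iN.
rewrite summxE big1 // => s _; rewrite !mxE eqxx /=.
case: eqP => [e|_]; last by rewrite mulr0.
by rewrite e codom_f in iN.
Qed.

(** * Assembling the two families of codes *)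

Lemma QUENTA_small_entanglement a b : (a <= q - 1)%N -> (1 <= b < q)%N -> (q - b <= a)%N ->
  QUENTA_code F (q ^ 2 - 1) (2 * (q - b) - 1) (b + 1) (2 * (q - a - 1)).
Proof.
move=> aq bq ab; have [w [w0 wb ww]] := exists_min_word bq.
set c := (2 * (q - a - 1))%N; set k := (2 * (q - b) - 1)%N.
(* Since [c <= 2b - 2], this gives [c + x = 2b - 1]: [P] and [G] are the rows orthogonal to [w], and
   [K] starts at row [2b - 1], which is not. All [2q - 2] rows are used. *)
pose x := (2 * b - 1 - c)%N; pose M := rows (c + (x + k)).
have mq : (c + (x + k) <= 2 * q - 2)%N by rewrite /x /c /k; lia.
have rP i : row i (usubmx M) = ph i by rewrite row_usubmx rowK.
have rG i : row i (usubmx (dsubmx M)) = ph (c + i)%N by rewrite row_usubmx row_dsubmx rowK.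
apply: (@QUENTA_of_blocks _ _ _ x _ _ (usubmx M) (usubmx (dsubmx M)) (dsubmx (dsubmx M))).
- by rewrite !vsubmxK rows_free.
- move=> y; rewrite vsubmxK => /submxP[v ->] y0.
  have -> : v *m dsubmx M = row_mx 0 v *m M.
    by rewrite -{2}[M]vsubmxK mul_row_col mul0mx add0r.
  apply: (leq_trans _ (rows_weight mq _)); first by lia.
  by apply: contra y0; rewrite row_mx_eq0 => /andP[_ /eqP ->]; rewrite mul0mx.
- move=> y /mul_trmx_eq0P yP /mul_trmx_eq0P yG; apply: dual_weight => // j jb.
  have [jc|jc] := ltnP j c; first by have := yP (Ordinal jc); rewrite rP.
  have jx : (j - c < x)%N by rewrite /x; lia.
  by have := yG (Ordinal jx); rewrite rG /= subnKC.
- exists w; split=> //.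
  + by apply/mul_trmx_eq0P => i; rewrite rP w0 //; have := ltn_ord i; rewrite /c; lia.
  + by apply/mul_trmx_eq0P => i; rewrite rG w0 //; have := ltn_ord i; rewrite /x; lia.
  + apply: contra wb => /eqP/mul_trmx_eq0P wK.
    have k0 : (0 < k)%N by rewrite /k; lia.
    have := wK (Ordinal k0); rewrite !row_dsubmx rowK /= addn0 => <-.
    by rewrite (_ : c + x = 2 * b - 1)%N // /x /c; lia.
Qed.

(** The vector [h] raises the size of [P] from [2b - 1] to [2b]. Orthogonality to [w] keeps the
    minimum weight word available, and lying outside the span keeps the blocks independent. *)
Lemma QUENTA_maximal_entanglement a b : (1 <= b)%N -> (a < q - b)%N ->
  QUENTA_code F (q ^ 2 - 1) (2 * a + 1) (b + 1) (2 * b - 1 + 1).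
Proof.
move=> b1 ab; have bq : (1 <= b < q)%N by lia.
have [w [w0 wb ww]] := exists_min_word bq.
set k := (2 * a + 1)%N; pose M := rows (2 * b - 1 + k).
have mq : (2 * b - 1 + k <= 2 * q - 2)%N by rewrite /k; lia.
have rP i : row i (usubmx M) = ph i by rewrite row_usubmx rowK.
(* The hyperplane orthogonal to [w] has dimension at least [q^2 - 2], while [M] has at most [2q - 2]
   rows. *)
have : ~~ (kermx w^T <= M)%MS.
  apply/negP => /mxrankS; rewrite mxrank_ker leqNgt => /negP[].
  apply: (leq_ltn_trans (rank_leq_row M)); have := rank_leq_col w^T.
  by move: (\rank _) => r; rewrite -mulnn; nia.
case/row_subPn => i hM; set h := row i _ in hM.
have hw : h *m w^T = 0 by rewrite /h -row_mul mulmx_ker row0.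
apply: (@QUENTA_of_blocks _ _ _ 0 _ _ (col_mx (usubmx M) h) 0 (dsubmx M)).
- apply: inj_row_free => v.
  rewrite -[v]hsubmxK -[lsubmx v]hsubmxK -[rsubmx v]hsubmxK !mul_row_col mulmx0 add0r.
  set v1 := lsubmx (lsubmx v); set v2 := rsubmx (lsubmx v); set v3 := rsubmx (rsubmx v).
  rewrite (thinmx0 (lsubmx (rsubmx v))) [v2]mx11_scalar mul_scalar_mx.
  have E : v1 *m usubmx M + v3 *m dsubmx M = row_mx v1 v3 *m M.
    by rewrite -{3}[M]vsubmxK mul_row_col.
  rewrite addrAC E => H.
  have v20 : v2 0 0 = 0.
    apply: contraNeq hM => v20; rewrite -(eqmx_scale _ v20).
    by move/eqP: H; rewrite addrC addr_eq0 => /eqP ->; rewrite -mulNmx submxMl.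
  move: H; rewrite v20 scale0r addr0 => H.
  have : row_mx v1 v3 = row_mx 0 0.
    by apply: (row_free_inj (rows_free mq)); rewrite row_mx0 mul0mx.
  by case/eq_row_mx => -> ->; rewrite raddf0 !row_mx0.
- move=> y; rewrite -addsmxE adds0mx => /submxP[v ->] y0.
  have -> : v *m dsubmx M = row_mx 0 v *m M.
    by rewrite -{2}[M]vsubmxK mul_row_col mul0mx add0r.
  apply: (leq_trans _ (rows_weight mq _)); first by lia.
  by apply: contra y0; rewrite row_mx_eq0 => /andP[_ /eqP ->]; rewrite mul0mx.
- move=> y; rewrite tr_col_mx mul_mx_row => /eqP.
  rewrite row_mx_eq0 => /andP[/eqP/mul_trmx_eq0P yP _] _; apply: dual_weight => // j jb.
  by have := yP (Ordinal jb); rewrite rP.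
- exists w; split=> //.
  + rewrite tr_col_mx mul_mx_row (_ : w *m h^T = 0); last first.
      by rewrite -[w]trmxK -trmx_mul hw trmx0.
    rewrite (_ : _ *m _ = 0) ?row_mx0 //.
    by apply/mul_trmx_eq0P => j; rewrite rP w0.
  + by rewrite trmx0 mulmx0.
  + apply: contra wb => /eqP/mul_trmx_eq0P wK.
    have k0 : (0 < k)%N by rewrite /k; lia.
    by have := wK (Ordinal k0); rewrite row_dsubmx rowK /= addn0 => <-.
Qed.
End Code.

Theorem mainTheorem6 (F : finFieldType) (a b : nat) :
  (2 < #|F|)%N -> (a <= #|F| - 1)%N -> (1 <= b <= #|F|)%N ->
  let q := #|F| in
  let n := (q ^ 2 - 1)%N in
  ((q - b <= a)%N -> (b < q)%N ->
      QUENTA_code F n (2 * (q - b) - 1) (b + 1) (2 * (q - a - 1))) /\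
  ((a < q - b)%N ->
      QUENTA_code F n (2 * a + 1) (b + 1) (2 * b - b %/ q)).
Proof.
move=> q2 aq /andP[b1 bq] q n.
have [L [iota cardL]] := exists_quadratic_ext F.
have [tr trE] := exists_trace iota cardL.
have [theta nf] := exists_not_fixed iota cardL.
have [c0 c0tr] := exists_trace_neq0 iota cardL.
have [pt [pi p0 ps]] := exists_points cardL.
split=> [ab bltq|ab].
  apply: (QUENTA_small_entanglement cardL q2 trE nf c0tr pi p0 ps) => //.
  by rewrite b1.
(* Here [a < q - b] forces [b < q], so the floor is 0. *)
rewrite divn_small -/q; last by lia.
rewrite (_ : 2 * b - 0 = 2 * b - 1 + 1)%N; last by lia.
exact: (QUENTA_maximal_entanglement cardL q2 trE nf c0tr pi p0 ps).
Qed.
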